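(* Let $\mathfrak{eb}_2$ be the Lie algebra over $\mathbb{R}$ generated by two elements $e,f$ subject to the relations $[e,[e,[e,f]]]=0$ and $[f,[f,e]]=-2f$. Then $\mathfrak{eb}_2$ is isomorphic to $\mathfrak{gl}_2$ (over $\mathbb{R}$). *)

(* Defs.v *)
From HB Require Import structures.
From mathcomp Require Import all_boot all_order all_algebra.
From mathcomp Require Import generic_quotient boolp reals.

Set Implicit Arguments.
Unset Strict Implicit.
Unset Printing Implicit Defensive.

Import GRing.Theory.
Local Open Scope ring_scope.
Local Open Scope quotient_scope.

HB.mixin Record isLieAlgebra (R : comPzRingType) L of GRing.Lmodule R L := {
  lie : L -> L -> L;
  lie_linearl : forall y, linear (lie^~ y);
  lie_linearr : forall x, linear (lie x);
  liexx : forall x, lie x x = 0;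
  lie_jacobi : forall x y z,
    lie x (lie y z) + lie y (lie z x) + lie z (lie x y) = 0
}.

#[short(type="lieAlgType")]
HB.structure Definition LieAlgebra (R : comPzRingType) :=
  {L of GRing.Lmodule R L & isLieAlgebra R L}.

Notation "[ 'lie' x , y ]" := (lie x y)
  (at level 0, x, y at level 99, format "[ 'lie'  x ,  y ]") : ring_scope.

Definition lie_morphism (R : comPzRingType) (L M : lieAlgType R)
    (phi : L -> M) : Prop :=
  linear phi /\ forall x y, phi [lie x, y] = [lie phi x, phi y].

Definition lie_isomorphic (R : comPzRingType) (L M : lieAlgType R) : Prop :=
  exists2 phi : L -> M, lie_morphism phi & bijective phi.

(* A type synonym, so that the commutator bracket is not put on every square  *)
(* matrix type.                                                               *)
Definition gl (R : comPzRingType) (n : nat) : Type := 'M[R]_n.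

Section GeneralLinear.
Variables (R : comPzRingType) (n : nat).

HB.instance Definition _ := GRing.Lmodule.on (gl R n).

Definition gl_bracket (A B : gl R n) : gl R n := A *m B - B *m A.

Fact gl_linearl B : linear (gl_bracket^~ B).
Proof.
move=> a A A'; rewrite /gl_bracket mulmxDl mulmxDr -scalemxAl -scalemxAr.
by rewrite scalerBr opprD addrACA.
Qed.

Fact gl_linearr A : linear (gl_bracket A).
Proof.
move=> a B B'; rewrite /gl_bracket mulmxDl mulmxDr -scalemxAl -scalemxAr.
by rewrite scalerBr opprD addrACA.
Qed.

Fact gl_bracketxx A : gl_bracket A A = 0.
Proof. exact: subrr. Qed.

Fact gl_jacobi A B C : gl_bracket A (gl_bracket B C) +
  gl_bracket B (gl_bracket C A) + gl_bracket C (gl_bracket A B) = 0.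
Proof.
rewrite /gl_bracket !mulmxBl !mulmxBr !mulmxA !opprB.
set a := A *m B *m C; set b := A *m C *m B; set c := B *m C *m A.
set d := C *m B *m A; set e := B *m A *m C; set f := C *m A *m B.
rewrite !addrA.
have -> : a - b + d - c + c - e + b - f + f - d + e - a =
  (a - a) + (b - b) + (c - c) + (d - d) + (e - e) + (f - f).
  by rewrite !addrA [LHS](AC 12%AC (1*12*7*2*5*4*3*10*11*6*9*8)%AC).
by rewrite !subrr !addr0.
Qed.

HB.instance Definition _ := isLieAlgebra.Build R (gl R n)
  gl_linearl gl_linearr gl_bracketxx gl_jacobi.

End GeneralLinear.

(* The Lie algebra presented by generators X and relations rel: formal Lie    *)
(* expressions in X, modulo the least congruence that contains the Lie algebra*)
(* axioms and rel. Its universal property is proved below.                    *)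
Inductive lie_term (R : comPzRingType) (X : Type) : Type :=
| TGen of X
| TZero
| TAdd of lie_term R X & lie_term R X
| TOpp of lie_term R X
| TScale of R & lie_term R X
| TLie of lie_term R X & lie_term R X.

Arguments TGen {R X}.
Arguments TZero {R X}.

HB.instance Definition _ (R : comPzRingType) (X : Type) :=
  gen_eqMixin (lie_term R X).
HB.instance Definition _ (R : comPzRingType) (X : Type) :=
  gen_choiceMixin (lie_term R X).

Inductive lie_cong (R : comPzRingType) (X : Type)
    (rel : lie_term R X -> lie_term R X -> Prop) :
    lie_term R X -> lie_term R X -> Prop :=
| Crel t u : rel t u -> lie_cong rel t u
| Crefl t : lie_cong rel t t
| Csym t u : lie_cong rel t u -> lie_cong rel u t
| Ctrans t u v : lie_cong rel t u -> lie_cong rel u v -> lie_cong rel t v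
| Cadd t t' u u' : lie_cong rel t t' -> lie_cong rel u u' ->
    lie_cong rel (TAdd t u) (TAdd t' u')
| Copp t t' : lie_cong rel t t' -> lie_cong rel (TOpp t) (TOpp t')
| Cscale a t t' : lie_cong rel t t' -> lie_cong rel (TScale a t) (TScale a t')
| Clie t t' u u' : lie_cong rel t t' -> lie_cong rel u u' ->
    lie_cong rel (TLie t u) (TLie t' u')
| CaddA t u v : lie_cong rel (TAdd t (TAdd u v)) (TAdd (TAdd t u) v)
| CaddC t u : lie_cong rel (TAdd t u) (TAdd u t)
| Cadd0 t : lie_cong rel (TAdd TZero t) t
| CaddN t : lie_cong rel (TAdd (TOpp t) t) TZero
| CscaleA a b t : lie_cong rel (TScale a (TScale b t)) (TScale (a * b) t)
| Cscale1 t : lie_cong rel (TScale 1 t) t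
| CscaleDr a t u :
    lie_cong rel (TScale a (TAdd t u)) (TAdd (TScale a t) (TScale a u))
| CscaleDl a b t :
    lie_cong rel (TScale (a + b) t) (TAdd (TScale a t) (TScale b t))
| CliePl a t u v :
    lie_cong rel (TLie (TAdd (TScale a t) u) v)
                 (TAdd (TScale a (TLie t v)) (TLie u v))
| CliePr a t u v :
    lie_cong rel (TLie v (TAdd (TScale a t) u))
                 (TAdd (TScale a (TLie v t)) (TLie v u))
| Cliexx t : lie_cong rel (TLie t t) TZero
| Cjacobi t u v :
    lie_cong rel (TAdd (TAdd (TLie t (TLie u v)) (TLie u (TLie v t)))
                       (TLie v (TLie t u)))
                 TZero.

Section Presentation.
Variables (R : comPzRingType) (X : Type).
Variable rel : lie_term R X -> lie_term R X -> Prop.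

Definition lie_congb (t u : lie_term R X) : bool := `[< lie_cong rel t u >].

Fact lie_congb_refl : reflexive lie_congb.
Proof. by move=> t; apply/asboolP; exact: Crefl. Qed.
Fact lie_congb_sym : symmetric lie_congb.
Proof. by move=> t u; apply/asboolP/asboolP; exact: Csym. Qed.
Fact lie_congb_trans : transitive lie_congb.
Proof.
by move=> u t v /asboolP tu /asboolP uv; apply/asboolP; exact: Ctrans tu uv.
Qed.

Canonical lie_cong_equiv :=
  EquivRel lie_congb lie_congb_refl lie_congb_sym lie_congb_trans.

Definition lie_pres : Type := {eq_quot lie_cong_equiv}.

HB.instance Definition _ := Choice.on lie_pres.
HB.instance Definition _ := Quotient.on lie_pres.

Definition lie_class (t : lie_term R X) : lie_pres := \pi_lie_pres t.

Lemma lie_classP t u : lie_class t = lie_class u <-> lie_cong rel t u.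
Proof.
by split=> [/eqP|tu]; [rewrite eqmodE => /asboolP | apply/eqP; rewrite eqmodE;
  apply/asboolP].
Qed.

Lemma lie_classK x : lie_class (repr x) = x.
Proof. exact: reprK. Qed.

Lemma repr_lie_class t : lie_cong rel (repr (lie_class t)) t.
Proof. by apply/lie_classP; rewrite lie_classK. Qed.

Definition pres_zero : lie_pres := lie_class TZero.
Definition pres_add (x y : lie_pres) := lie_class (TAdd (repr x) (repr y)).
Definition pres_opp (x : lie_pres) := lie_class (TOpp (repr x)).
Definition pres_scale a (x : lie_pres) := lie_class (TScale a (repr x)).
Definition pres_lie (x y : lie_pres) := lie_class (TLie (repr x) (repr y)).

Fact pres_addE t u :
  pres_add (lie_class t) (lie_class u) = lie_class (TAdd t u).
Proof. by apply/lie_classP; apply: Cadd; exact: repr_lie_class. Qed.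
Fact pres_oppE t : pres_opp (lie_class t) = lie_class (TOpp t).
Proof. by apply/lie_classP; apply: Copp; exact: repr_lie_class. Qed.
Fact pres_scaleE a t : pres_scale a (lie_class t) = lie_class (TScale a t).
Proof. by apply/lie_classP; apply: Cscale; exact: repr_lie_class. Qed.
Fact pres_lieE t u :
  pres_lie (lie_class t) (lie_class u) = lie_class (TLie t u).
Proof. by apply/lie_classP; apply: Clie; exact: repr_lie_class. Qed.

Let presE := (pres_addE, pres_oppE, pres_scaleE, pres_lieE).

Fact pres_addA : associative pres_add.
Proof.
move=> x y z; rewrite -[x]lie_classK -[y]lie_classK -[z]lie_classK !presE.
by apply/lie_classP; exact: CaddA.
Qed.
Fact pres_addC : commutative pres_add.
Proof.
move=> x y; rewrite -[x]lie_classK -[y]lie_classK !presE.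
by apply/lie_classP; exact: CaddC.
Qed.
Fact pres_add0 : left_id pres_zero pres_add.
Proof.
by move=> x; rewrite -[x]lie_classK !presE; apply/lie_classP; exact: Cadd0.
Qed.
Fact pres_addN : left_inverse pres_zero pres_opp pres_add.
Proof.
by move=> x; rewrite -[x]lie_classK !presE; apply/lie_classP; exact: CaddN.
Qed.

HB.instance Definition _ := GRing.isZmodule.Build lie_pres
  pres_addA pres_addC pres_add0 pres_addN.

Fact pres_scaleA a b x : pres_scale a (pres_scale b x) = pres_scale (a * b) x.
Proof.
by rewrite -[x]lie_classK !presE; apply/lie_classP; exact: CscaleA.
Qed.
Fact pres_scale1 : left_id 1 pres_scale.
Proof.
by move=> x; rewrite -[x]lie_classK !presE; apply/lie_classP; exact: Cscale1.
Qed.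
Fact pres_scaleDr : right_distributive pres_scale +%R.
Proof.
move=> a x y; rewrite -[x]lie_classK -[y]lie_classK /GRing.add /= !presE.
by apply/lie_classP; exact: CscaleDr.
Qed.
Fact pres_scaleDl x : {morph pres_scale^~ x : a b / a + b}.
Proof.
move=> a b /=; rewrite -[x]lie_classK.
rewrite -[RHS]/(pres_add (pres_scale a _) (pres_scale b _)) !presE.
by apply/lie_classP; exact: CscaleDl.
Qed.

HB.instance Definition _ := GRing.Zmodule_isLmodule.Build R lie_pres
  pres_scaleA pres_scale1 pres_scaleDr pres_scaleDl.

Lemma lie_class0 : lie_class TZero = 0. Proof. by []. Qed.
Lemma lie_classD t u : lie_class (TAdd t u) = lie_class t + lie_class u.
Proof. by rewrite -pres_addE. Qed.
Lemma lie_classN t : lie_class (TOpp t) = - lie_class t.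
Proof. by rewrite -pres_oppE. Qed.
Lemma lie_classZ a t : lie_class (TScale a t) = a *: lie_class t.
Proof. by rewrite -pres_scaleE. Qed.

Fact pres_lie_linearl y : linear (pres_lie^~ y).
Proof.
move=> a x x'; rewrite -[x]lie_classK -[x']lie_classK -[y]lie_classK.
rewrite -lie_classZ -lie_classD !pres_lieE -lie_classZ -lie_classD.
by apply/lie_classP; exact: CliePl.
Qed.
Fact pres_lie_linearr x : linear (pres_lie x).
Proof.
move=> a y y'; rewrite -[x]lie_classK -[y]lie_classK -[y']lie_classK.
rewrite -lie_classZ -lie_classD !pres_lieE -lie_classZ -lie_classD.
by apply/lie_classP; exact: CliePr.
Qed.
Fact pres_liexx x : pres_lie x x = 0.
Proof.
by rewrite -[x]lie_classK pres_lieE; apply/lie_classP; exact: Cliexx.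
Qed.
Fact pres_jacobi x y z : pres_lie x (pres_lie y z) +
  pres_lie y (pres_lie z x) + pres_lie z (pres_lie x y) = 0.
Proof.
rewrite -[x]lie_classK -[y]lie_classK -[z]lie_classK !pres_lieE -!lie_classD.
by apply/lie_classP; exact: Cjacobi.
Qed.

HB.instance Definition _ := isLieAlgebra.Build R lie_pres
  pres_lie_linearl pres_lie_linearr pres_liexx pres_jacobi.

Lemma lie_class_lie t u :
  lie_class (TLie t u) = [lie lie_class t, lie_class u].
Proof. by rewrite -pres_lieE. Qed.

Definition lie_gen (x : X) : lie_pres := lie_class (TGen x).

End Presentation.

Fixpoint lie_eval (R : comPzRingType) (X : Type) (L : lieAlgType R)
    (g : X -> L) (t : lie_term R X) : L :=
  match t with
  | TGen x => g x
  | TZero => 0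
  | TAdd t u => lie_eval g t + lie_eval g u
  | TOpp t => - lie_eval g t
  | TScale a t => a *: lie_eval g t
  | TLie t u => [lie lie_eval g t, lie_eval g u]
  end.

Section UniversalProperty.
Variables (R : comPzRingType) (X : Type).
Variable rel : lie_term R X -> lie_term R X -> Prop.

Lemma lie_eval_gen t : lie_eval (lie_gen rel) t = lie_class rel t.
Proof.
elim: t => //= [t -> u ->|t ->|a t ->|t -> u ->].
- by rewrite lie_classD.
- by rewrite lie_classN.
- by rewrite lie_classZ.
- by rewrite lie_class_lie.
Qed.

Lemma lie_gen_rel t u : rel t u ->
  lie_eval (lie_gen rel) t = lie_eval (lie_gen rel) u.
Proof. by move=> tu; rewrite !lie_eval_gen; apply/lie_classP; exact: Crel. Qed.

Variables (L : lieAlgType R) (g : X -> L).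
Hypothesis g_rel : forall t u, rel t u -> lie_eval g t = lie_eval g u.

Lemma lie_eval_cong t u : lie_cong rel t u -> lie_eval g t = lie_eval g u.
Proof.
elim=> {t u} //=.
- by move=> t u v _ -> _ ->.
- by move=> t t' u u' _ -> _ ->.
- by move=> t t' _ ->.
- by move=> a t t' _ ->.
- by move=> t t' u u' _ -> _ ->.
- by move=> t u v; rewrite addrA.
- by move=> t u; rewrite addrC.
- by move=> t; rewrite add0r.
- by move=> t; rewrite addNr.
- by move=> a b t; rewrite scalerA.
- by move=> t; rewrite scale1r.
- by move=> a t u; rewrite scalerDr.
- by move=> a b t; rewrite scalerDl.
- by move=> a t u v; rewrite lie_linearl.
- by move=> a t u v; rewrite lie_linearr.
- by move=> t; rewrite liexx.
- by move=> t u v; rewrite lie_jacobi.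
Qed.

Theorem lie_pres_universal : exists! phi : lie_pres rel -> L,
  lie_morphism phi /\ forall x, phi (lie_gen rel x) = g x.
Proof.
pose phi (x : lie_pres rel) := lie_eval g (repr x).
have phiE t : phi (lie_class rel t) = lie_eval g t.
  by apply: lie_eval_cong; exact: repr_lie_class.
exists phi; split=> [|psi [[psi_lin psi_lie] psi_gen]].
  split; last by move=> x; rewrite phiE.
  split=> [a x y|x y]; rewrite -[x]lie_classK -[y]lie_classK.
    by rewrite -lie_classZ -lie_classD !phiE.
  by rewrite -lie_class_lie !phiE.
apply/funext=> x; rewrite -[x]lie_classK phiE; move: (repr x) => t.
have psi0 : psi 0 = 0.
  have := psi_lin (-1) 0 0.
  by rewrite scaleN1r oppr0 addr0 scaleN1r addNr.
have psiZ a y : psi (a *: y) = a *: psi y.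
  by rewrite -[a *: y]addr0 psi_lin psi0 addr0.
have psiD y z : psi (y + z) = psi y + psi z.
  by rewrite -[y]scale1r psi_lin !scale1r.
elim: t => /= [y||t -> u ->|t ->|a t ->|t -> u ->].
- by rewrite -psi_gen.
- by rewrite lie_class0 psi0.
- by rewrite lie_classD psiD.
- by rewrite lie_classN -[- lie_class _ _]scaleN1r psiZ scaleN1r.
- by rewrite lie_classZ psiZ.
- by rewrite lie_class_lie psi_lie.
Qed.

End UniversalProperty.

Inductive eb2_index : Type := Ie | If.

Inductive eb2_rel (R : comPzRingType) :
    lie_term R eb2_index -> lie_term R eb2_index -> Prop :=
| eb2_rel_eeef : eb2_rel
    (TLie (TGen Ie) (TLie (TGen Ie) (TLie (TGen Ie) (TGen If)))) TZero
| eb2_rel_ffe : eb2_rel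
    (TLie (TGen If) (TLie (TGen If) (TGen Ie))) (TScale (- 2%:R) (TGen If)).

Definition eb2 (R : comPzRingType) : lieAlgType R := lie_pres (@eb2_rel R).

Definition eb2_e (R : comPzRingType) : eb2 R := lie_gen (@eb2_rel R) Ie.
Definition eb2_f (R : comPzRingType) : eb2 R := lie_gen (@eb2_rel R) If.

Lemma eb2_eeef (R : comPzRingType) :
  [lie eb2_e R, [lie eb2_e R, [lie eb2_e R, eb2_f R]]] = 0.
Proof. exact: (lie_gen_rel (@eb2_rel_eeef R)). Qed.

Lemma eb2_ffe (R : comPzRingType) :
  [lie eb2_f R, [lie eb2_f R, eb2_e R]] = - 2%:R *: eb2_f R.
Proof. exact: (lie_gen_rel (@eb2_rel_ffe R)). Qed.

(* Main.v *)
Require Import Defs.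
From mathcomp Require Import all_boot all_order all_algebra reals.
From mathcomp Require Import ring.

(** Write [h = [e,f]] and [u = [e,h]], so that the two relations say
    [[e,u] = 0] and [[f,h] = 2f].  The Jacobi identity then gives
    [[f,u] = 2h] and [[h,u] = 2u].  Hence, with [E = - u/2], the triple
    [(E, h, f)] satisfies the relations of sl_2, and the difference [c = e - E]
    commutes with [f] and with [E].  As [e = E + c], the presented algebra is
    generated by an sl_2-triple and an element commuting with it, which is what
    gl_2 is, as the direct sum of sl_2 and the scalar matrices.

    To make this an isomorphism, two Lie morphisms are exhibited.  The
    universal property of the presentation yields one to gl_2, sending [e] to
    [E_12 + 1] and [f] to [E_21].  In the other direction, an sl_2-triple and
    an element commuting with it always define a Lie morphism from gl_2
    (lemma [gl2_map_lie]).  They are mutually inverse: on gl_2 by evaluation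
    at a matrix, on the presented algebra because an endomorphism is determined
    by its values on the generators. *)

Set Implicit Arguments.
Unset Strict Implicit.
Unset Printing Implicit Defensive.

Import GRing.Theory.
Local Open Scope ring_scope.

(** * Bilinearity and morphisms *)

Section Bilinearity.
Variables (R : comPzRingType) (L : lieAlgType R).
Implicit Types (a : R) (x y z : L).

Lemma lieDl x y z : [lie x + y, z] = [lie x, z] + [lie y, z].
Proof. by have := lie_linearl z 1 x y; rewrite /= !scale1r. Qed.

Lemma lieDr x y z : [lie z, x + y] = [lie z, x] + [lie z, y].
Proof. by have := lie_linearr z 1 x y; rewrite !scale1r. Qed.

Lemma lie0l z : [lie 0, z] = 0.
Proof. by apply: (addrI [lie 0, z]); rewrite -lieDl !addr0. Qed.

Lemma lie0r z : [lie z, 0] = 0.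
Proof. by apply: (addrI [lie z, 0]); rewrite -lieDr !addr0. Qed.

Lemma lieZl a x z : [lie a *: x, z] = a *: [lie x, z].
Proof. by have := lie_linearl z a x 0; rewrite /= lie0l !addr0. Qed.

Lemma lieZr a x z : [lie z, a *: x] = a *: [lie z, x].
Proof. by have := lie_linearr z a x 0; rewrite lie0r !addr0. Qed.

Lemma lieC x y : [lie x, y] = - [lie y, x].
Proof.
have := liexx (x + y); rewrite lieDl !lieDr !liexx add0r addr0.
by move/eqP; rewrite addr_eq0 => /eqP.
Qed.

Lemma lieNl x z : [lie - x, z] = - [lie x, z].
Proof. by rewrite -scaleN1r lieZl scaleN1r. Qed.

Lemma lieNr x z : [lie z, - x] = - [lie z, x].
Proof. by rewrite -scaleN1r lieZr scaleN1r. Qed.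

(** The Jacobi identity in the form: [ad x] is a derivation. *)
Lemma lie_derivation x y z :
  [lie x, [lie y, z]] = [lie [lie x, y], z] + [lie y, [lie x, z]].
Proof.
apply/eqP; rewrite -subr_eq0 opprD addrA; apply/eqP.
rewrite -[RHS](lie_jacobi x y z) [in RHS](lieC z x) lieNr.
by rewrite [in RHS](lieC z) addrAC.
Qed.

End Bilinearity.

Section Morphisms.
Variables (R : comPzRingType) (L M : lieAlgType R) (phi : L -> M).
Hypothesis phi_lie : lie_morphism phi.

Lemma lie_morphismD x y : phi (x + y) = phi x + phi y.
Proof. by have := phi_lie.1 1 x y; rewrite !scale1r. Qed.

Lemma lie_morphismZ a x : phi (a *: x) = a *: phi x.
Proof.
have phi0 : phi 0 = 0 by apply: (addrI (phi 0)); rewrite -lie_morphismD !addr0.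
by have := phi_lie.1 a x 0; rewrite phi0 !addr0.
Qed.

Lemma lie_morphismB x y : phi (x - y) = phi x - phi y.
Proof. by rewrite lie_morphismD -scaleN1r lie_morphismZ scaleN1r. Qed.

End Morphisms.

Lemma lie_morphism_comp (R : comPzRingType) (L M N : lieAlgType R)
    (psi : M -> N) (phi : L -> M) :
  lie_morphism psi -> lie_morphism phi -> lie_morphism (psi \o phi).
Proof.
move=> [psi_lin psi_lie] [phi_lin phi_lie]; split=> [a x y|x y] /=.
  by rewrite phi_lin psi_lin.
by rewrite phi_lie psi_lie.
Qed.

(** Uniqueness in the universal property, applied to the generators themselves:
    both [phi] and the identity extend them. *)
Lemma lie_pres_endo_id (R : comPzRingType) (X : Type)
    (rel : lie_term R X -> lie_term R X -> Prop)
    (phi : lie_pres rel -> lie_pres rel) :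
  lie_morphism phi -> (forall x, phi (lie_gen rel x) = lie_gen rel x) ->
  phi =1 id.
Proof.
move=> phi_lie phi_gen t.
have [theta [_ theta_uniq]] := lie_pres_universal (@lie_gen_rel R X rel).
rewrite -(theta_uniq phi); last by split.
by rewrite (theta_uniq id).
Qed.

(** * Lie morphisms from gl_2 *)

Lemma gl2_lieE (R : comPzRingType) (A B : gl R 2) i j :
  [lie A, B] i j =
    A i 0 * B 0 j + A i 1 * B 1 j - (B i 0 * A 0 j + B i 1 * A 1 j).
Proof.
have -> : [lie A, B] = A *m B - B *m A :> 'M_2 by [].
have lift01 : lift ord0 ord0 = 1 :> 'I_2 by apply/val_inj.
by rewrite !mxE !big_ord_recl !big_ord0 lift01 !addr0.
Qed.

Section FromGl2.
Variables (R : fieldType) (L : lieAlgType R).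
Hypothesis two_neq0 : 2%:R != 0 :> R.
Variables E f h c : L.

(** The four coefficients are the coordinates of a matrix in the basis E_12,
    E_21, E_11 - E_22, 1 of gl_2. *)
Definition gl2_map (A : gl R 2) : L :=
  A 0 1 *: E + A 1 0 *: f + ((A 0 0 - A 1 1) / 2%:R) *: h
  + ((A 0 0 + A 1 1) / 2%:R) *: c.

Lemma gl2_map_linear : linear gl2_map.
Proof.
move=> a A B; rewrite /gl2_map !mxE !scalerDr !scalerA.
rewrite [RHS]addrACA; congr (_ + _); last first.
  by rewrite -scalerDl; congr (_ *: _); field.
rewrite [RHS]addrACA; congr (_ + _); last first.
  by rewrite -scalerDl; congr (_ *: _); field.
by rewrite [RHS]addrACA; congr (_ + _); rewrite -scalerDl.
Qed.

Hypotheses (Ef : [lie E, f] = h) (hE : [lie h, E] = 2%:R *: E).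
Hypothesis hf : [lie h, f] = - 2%:R *: f.
Hypotheses (cE : [lie c, E] = 0) (cf : [lie c, f] = 0).

(** Linearity reduces this to the brackets of the basis, and [c] commutes with
    all of it: with [h] because [h] is a bracket of [E] and [f]. *)
Lemma gl2_map_lie : lie_morphism gl2_map.
Proof.
split=> [|A B]; first exact: gl2_map_linear.
have ch : [lie c, h] = 0 by rewrite -Ef lie_derivation cE cf lie0l lie0r addr0.
have fE : [lie f, E] = - h by rewrite lieC Ef.
have Eh : [lie E, h] = - 2%:R *: E by rewrite lieC hE scaleNr.
have fh : [lie f, h] = 2%:R *: f by rewrite lieC hf scaleNr opprK.
have Ec : [lie E, c] = 0 by rewrite lieC cE oppr0.
have fc : [lie f, c] = 0 by rewrite lieC cf oppr0.
have hc : [lie h, c] = 0 by rewrite lieC ch oppr0.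
rewrite /gl2_map !(lieDl, lieDr) !(lieZl, lieZr) !liexx.
rewrite Ef hE hf cE cf ch fE Eh fh Ec fc hc !scaler0 !addr0 !add0r.
rewrite !scalerN !scalerA -!scaleNr.
rewrite !gl2_lieE.
(* Groups the six terms by the basis element E, f or h that they multiply. *)
have -> : forall v1 v2 v3 v4 v5 v6 : L, v1 + v2 + (v3 + v4) + (v5 + v6) =
    (v2 + v5) + (v4 + v6) + (v1 + v3).
  by move=> *; rewrite [LHS](AC (2*2*2) ((2*5)*(4*6)*(1*3))).
rewrite -!scalerDl -[RHS]addr0 -(scale0r c).
by congr (_ *: _ + _ *: _ + _ *: _ + _ *: _); field.
Qed.

End FromGl2.

Lemma lie_morphism_gl2_map (R : fieldType) (L M : lieAlgType R) (phi : L -> M)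
    (E f h c : L) (A : gl R 2) : lie_morphism phi ->
  phi (gl2_map E f h c A) = gl2_map (phi E) (phi f) (phi h) (phi c) A.
Proof.
by move=> phi_lie; rewrite /gl2_map !(lie_morphismD phi_lie) !(lie_morphismZ phi_lie).
Qed.

(** * The sl_2-triple and the central element *)

Section Eb2Relations.
Variables (R : fieldType) (L : lieAlgType R).
Hypothesis two_neq0 : 2%:R != 0 :> R.
Variables e f : L.
Hypothesis eeef : [lie e, [lie e, [lie e, f]]] = 0.
Hypothesis ffe : [lie f, [lie f, e]] = - 2%:R *: f.

Let h := [lie e, f].
Let u := [lie e, h].
(** The raising element of the sl_2-triple whose lowering element is [f] and
    whose Cartan element is [[e,f]]. *)
Definition eb2_raising : L := - 2%:R^-1 *: [lie e, [lie e, f]].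
Local Notation E := eb2_raising.

Let fh : [lie f, h] = 2%:R *: f.
Proof. by rewrite /h (lieC e) lieNr ffe scaleNr opprK. Qed.

(* [ad f] is a derivation sending e to -h and h to 2f, and [h, h] = 0. *)
Let fu : [lie f, u] = 2%:R *: h.
Proof. by rewrite lie_derivation fh (lieC f e) lieNl liexx oppr0 add0r lieZr. Qed.

(* [ad u] is a derivation killing e, since eeef says [e, u] = 0. *)
Let hu : [lie h, u] = 2%:R *: u.
Proof.
rewrite lieC {1}/h lie_derivation (lieC u e) eeef oppr0 lie0l add0r.
by rewrite (lieC u f) fu lieNr lieZr opprK.
Qed.

Lemma eb2_raising_lower : [lie E, f] = [lie e, f].
Proof.
by rewrite lieZl lieC fu scalerN scaleNr opprK scalerA mulVf // scale1r.
Qed.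

Lemma eb2_cartan_raising : [lie [lie e, f], E] = 2%:R *: E.
Proof. by rewrite lieZr hu !scalerA mulrC. Qed.

Lemma eb2_cartan_lower : [lie [lie e, f], f] = - 2%:R *: f.
Proof. by rewrite lieC fh scaleNr. Qed.

Lemma eb2_center_raising : [lie e - E, E] = 0.
Proof. by rewrite lieDl lieNl liexx oppr0 addr0 lieZr eeef scaler0. Qed.

Lemma eb2_center_lower : [lie e - E, f] = 0.
Proof. by rewrite lieDl lieNl eb2_raising_lower subrr. Qed.

End Eb2Relations.

Lemma lie_morphism_eb2_raising (R : fieldType) (L M : lieAlgType R)
    (phi : L -> M) (e f : L) : lie_morphism phi ->
  phi (eb2_raising e f) = eb2_raising (phi e) (phi f).
Proof.
by move=> phi_lie; rewrite /eb2_raising (lie_morphismZ phi_lie) !phi_lie.2.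
Qed.

(** * The isomorphism *)

(** [e] goes to E_12 + 1 and [f] to E_21.  The summand 1 does not affect the
    relations, where [e] occurs only inside brackets, and is there to reach
    the center of gl_2. *)
Definition eb2_to_gl2_gen (R : comPzRingType) (x : eb2_index) : gl R 2 :=
  match x with
  | Ie => \matrix_(i, j) ((i <= j)%N%:R)
  | If => \matrix_(i, j) ((j < i)%N%:R)
  end.

Lemma eb2_to_gl2_rel (R : comPzRingType) t u :
  @eb2_rel R t u ->
  lie_eval (eb2_to_gl2_gen R) t = lie_eval (eb2_to_gl2_gen R) u.
Proof.
by case=> /=; apply/matrixP=> i j; rewrite [RHS]mxE !gl2_lieE !mxE;
  case: i => [[|[|//]] ?]; case: j => [[|[|//]] ?] /=; ring.
Qed.

Lemma eb2_to_gl2_cartan (R : comPzRingType) :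
  [lie eb2_to_gl2_gen R Ie, eb2_to_gl2_gen R If] =
    \matrix_(i, j) ((i == j)%:R * (-1) ^+ i) :> gl R 2.
Proof.
apply/matrixP=> i j; rewrite gl2_lieE !mxE.
by case: i => [[|[|//]] ?]; case: j => [[|[|//]] ?] /=; ring.
Qed.

Lemma eb2_to_gl2_raising (R : fieldType) : 2%:R != 0 :> R ->
  eb2_raising (eb2_to_gl2_gen R Ie) (eb2_to_gl2_gen R If) =
    delta_mx 0 1 :> gl R 2.
Proof.
move=> two_neq0; rewrite /eb2_raising eb2_to_gl2_cartan.
apply/matrixP=> i j; rewrite mxE gl2_lieE !mxE.
by case: i => [[|[|//]] ?]; case: j => [[|[|//]] ?] /=; field.
Qed.

(** The images of the sl_2-triple and of the central element in gl_2 are the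
    matrices on which [gl2_map] takes coordinates. *)
Lemma eb2_to_gl2_genK (R : fieldType) (A : gl R 2) : 2%:R != 0 :> R ->
  let e := eb2_to_gl2_gen R Ie in let f := eb2_to_gl2_gen R If in
  gl2_map (eb2_raising e f) f [lie e, f] (e - eb2_raising e f) A = A.
Proof.
move=> two_neq0 e f; rewrite eb2_to_gl2_raising // eb2_to_gl2_cartan.
have ord2 (k : 'I_2) : k = 0 \/ k = 1.
  by case: k => [[|[|//]] ?]; [left | right]; exact: val_inj.
apply/matrixP=> i j; rewrite /gl2_map !mxE.
by case: (ord2 i) => ->; case: (ord2 j) => -> /=; field.
Qed.

Theorem lemma5p4 (R : realType) : lie_isomorphic (eb2 R) (gl R 2).
Proof.
have two_neq0 : 2%:R != 0 :> R by rewrite Num.Theory.pnatr_eq0.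
have [phi [[phi_lie phi_gen] _]] := lie_pres_universal (@eb2_to_gl2_rel R).
have [_ phi_br] := phi_lie.
set e := eb2_e R; set f := eb2_f R.
have eeef := eb2_eeef R; have ffe := eb2_ffe R.
pose E := eb2_raising e f.
pose psi : gl R 2 -> eb2 R := gl2_map E f [lie e, f] (e - E).
have psi_lie : lie_morphism psi.
  apply: gl2_map_lie => //.
  - exact: eb2_raising_lower.
  - exact: eb2_cartan_raising.
  - exact: eb2_cartan_lower.
  - exact: eb2_center_raising.
  - exact: eb2_center_lower.
exists phi => //; exists psi.
  apply: (@lie_pres_endo_id _ _ _ (psi \o phi)).
    exact: lie_morphism_comp.
  case; rewrite /= phi_gen /psi /gl2_map !mxE /= !(subrr, mul0r, scale0r).
    by rewrite !(addr0, scale1r) divff // scale1r addrC subrK.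
  by rewrite !(addr0, add0r, mul0r, scale0r) scale1r.
move=> A; rewrite /psi (lie_morphism_gl2_map _ _ _ _ _ phi_lie) (lie_morphismB phi_lie).
rewrite (lie_morphism_eb2_raising _ _ phi_lie) phi_br !phi_gen.
exact: eb2_to_gl2_genK.
Qed.
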